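(* Let $\Omega\subset\mathbb{R}^2$ be a connected domain with piecewise smooth boundary, and let $\Omega_{rect}^{(upper)}$ be the minimal rectangle that $\Omega$ is a subset of. Let $w(x,y,t)$ be a solution to $$w_t=\Delta w+f(w),\quad (x,y)\in\Omega_{rect}^{(upper)},\ t>0,$$ $$w=0,\quad (x,y)\in\partial\Omega_{rect}^{(upper)},\ t>0,$$ $$w=0,\quad (x,y)\in\overline{\Omega}_{rect}^{(upper)},\ t=0.$$ Then $w$ restricted to the domain $\overline{\Omega}_{rect}^{(upper)}\cap\overline{\Omega}$ is an upper solution.
   Context: The underlying problem is a quenching reaction-diffusion equation on $\Omega$ with solution $u$, reactive term $f(u)$ and Dirichlet boundary conditions. The function $f$ is nonlinear, positive and strictly increasing for $0\le u<1$, and $f(u)\to\infty$ as $u\to1^-$. An upper solution is a function $w(x,y,t)$ that satisfies $w_t\ge\Delta w+f(w)$ for $(x,y)\in\Omega$, $t>0$; $w\ge 0$ for $(x,y)\in\partial\Omega$, $t>0$; and $w\ge0$ for $(x,y)\in\overline{\Omega}$, $t=0$. *)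

(* Defs.v *)
From HB Require Import structures.
From mathcomp Require Export all_boot all_order all_algebra.
From mathcomp Require Export all_classical all_reals all_analysis.
Export Order.TTheory GRing.Theory Num.Theory.
Export numFieldNormedType.Exports.

Set Implicit Arguments.
Unset Strict Implicit.
Unset Printing Implicit Defensive.

Local Open Scope ring_scope.
Local Open Scope classical_set_scope.

Definition boundary (T : topologicalType) (A : set T) : set T :=
  closure A `\` interior A.

(* A simple regular C^1 arc, as the image of [0, 1]. Asking for a C^1 function
   on the whole line is no restriction: a function that is C^1 up to the
   endpoints of [0, 1] extends affinely. *)
Record C1_arc (R : realType) (g : R -> R * R) : Prop := {
  arc_derivable : forall s : R, derivable g s 1;
  arc_C1 : continuous (derive1 g);
  arc_regular : forall s : R, 0 <= s <= 1 -> derive1 g s != 0;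
  arc_injective : forall s t : R,
    0 <= s <= 1 -> 0 <= t <= 1 -> g s = g t -> s = t }.

(* The boundary is a finite union of C^1 arcs meeting only at their endpoints.
   A smooth closed curve is cut into several arcs. *)
Definition piecewise_smooth_boundary (R : realType) (Omega : set (R * R)) : Prop :=
  exists (n : nat) (g : 'I_n -> R -> R * R),
    [/\ forall i, C1_arc (g i),
        forall (i j : 'I_n) (s t : R), i != j -> 0 <= s <= 1 -> 0 <= t <= 1 ->
          g i s = g j t -> (s = 0 \/ s = 1) /\ (t = 0 \/ t = 1)
      & boundary Omega = \bigcup_(i in [set: 'I_n]) (g i @` `[0, 1])].

Definition open_rectangle (R : realType) (Q : set (R * R)) : Prop :=
  exists a b c d : R, [/\ a < b, c < d & Q = `]a, b[ `*` `]c, d[].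

Definition minimal_rectangle (R : realType) (Omega Q : set (R * R)) : Prop :=
  [/\ open_rectangle Q, Omega `<=` Q &
      forall Q', open_rectangle Q' -> Omega `<=` Q' -> Q `<=` Q'].

(* D is the domain of the reactive term f: values of f outside D are
   meaningless, and equations involving f (w) include the requirement that w
   takes its values in D. The properties of f are prescribed on [0, 1) only.
   D = [0, 1) is allowed, and then reaction_cont is void; for an f also defined
   at negative arguments (such as 1 / (1 - u) on u < 1), reaction_cont excludes
   a jump of f at 0 to negative values. *)
Record reaction_term (R : realType) (D : set R) (f : R -> R) : Prop := {
  reaction_dom : `[0, 1[ `<=` D;
  reaction_dom_lt1 : D `<=` `]-oo, 1[;
  reaction_cont : {within D `&` `]-oo, 0], continuous f};
  reaction_nonlinear :
    ~ exists a b : R, forall u : R, 0 <= u < 1 -> f u = a * u + b;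
  reaction_gt0 : forall u : R, 0 <= u < 1 -> 0 < f u;
  reaction_incr : forall u v : R,
    0 <= u < 1 -> 0 <= v < 1 -> u < v -> f u < f v;
  reaction_blowup : f u @[u --> 1^'-] --> +oo }.

Section Derivatives.
Variables (R : realType) (w : R * R -> R -> R).

Definition d_t (p : R * R) (t : R) : R := derive1 (w p) t.
Definition d_x (p : R * R) (t : R) : R := derive1 (fun x => w (x, p.2) t) p.1.
Definition d_y (p : R * R) (t : R) : R := derive1 (fun y => w (p.1, y) t) p.2.

End Derivatives.

Definition laplacian (R : realType) (w : R * R -> R -> R) (p : R * R) (t : R) : R :=
  d_x (d_x w) p t + d_y (d_y w) p t.

(* The time interval is 0 < t < T with T in (0, +oo]: a solution may quench in
   finite time. *)
Definition in_time (R : realType) (T : \bar R) (t : R) : Prop :=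
  0 < t /\ (t%:E < T)%E.

(* The derivatives in the equation exist on Omega for 0 < t < T, and w is
   continuous up to the spatial boundary and the initial time. *)
Record regular (R : realType) (T : \bar R) (Omega : set (R * R))
    (w : R * R -> R -> R) : Prop := {
  regular_cont :
    {within closure Omega `*` [set t | 0 <= t /\ (t%:E < T)%E],
      continuous (fun q : (R * R) * R => w q.1 q.2)};
  regular_t : forall (p : R * R) (t : R), Omega p -> in_time T t -> derivable (w p) t 1;
  regular_x : forall (p : R * R) (t : R), Omega p -> in_time T t ->
    derivable (fun x => w (x, p.2) t) p.1 1;
  regular_y : forall (p : R * R) (t : R), Omega p -> in_time T t ->
    derivable (fun y => w (p.1, y) t) p.2 1;
  regular_xx : forall (p : R * R) (t : R), Omega p -> in_time T t ->
    derivable (fun x => d_x w (x, p.2) t) p.1 1;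
  regular_yy : forall (p : R * R) (t : R), Omega p -> in_time T t ->
    derivable (fun y => d_y w (p.1, y) t) p.2 1 }.

Record solution (R : realType) (D : set R) (f : R -> R) (T : \bar R)
    (Omega : set (R * R)) (w : R * R -> R -> R) : Prop := {
  solution_regular : regular T Omega w;
  solution_dom : forall (p : R * R) (t : R), Omega p -> in_time T t -> D (w p t);
  solution_eq : forall (p : R * R) (t : R), Omega p -> in_time T t ->
    d_t w p t = laplacian w p t + f (w p t);
  solution_boundary : forall (p : R * R) (t : R), boundary Omega p -> in_time T t -> w p t = 0;
  solution_initial : forall p : R * R, closure Omega p -> w p 0 = 0 }.

Record upper_solution (R : realType) (D : set R) (f : R -> R) (T : \bar R)
    (Omega : set (R * R)) (w : R * R -> R -> R) : Prop := {
  upper_regular : regular T Omega w;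
  upper_dom : forall (p : R * R) (t : R), Omega p -> in_time T t -> D (w p t);
  upper_ineq : forall (p : R * R) (t : R), Omega p -> in_time T t ->
    laplacian w p t + f (w p t) <= d_t w p t;
  upper_boundary : forall (p : R * R) (t : R), boundary Omega p -> in_time T t -> 0 <= w p t;
  upper_initial : forall p : R * R, closure Omega p -> 0 <= w p 0 }.

(* Main.v *)
(* On the open set Omega the restriction has the same derivatives as w, so only
   the sign of w on the part of the boundary of Omega inside the rectangle Q is
   at stake, and w >= 0 holds on all of Q. Otherwise, for a small e > 0 take the
   first time s at which w reaches -e, at a point q of Q: there w (., s) has a
   spatial minimum equal to -e, hence w_t <= 0 <= Laplacian of w, and
   f (-e) > 0 by continuity of f at 0, which contradicts the equation. *)
Require Import Defs.
From mathcomp Require Import lra.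
Set Implicit Arguments.
Unset Strict Implicit.
Unset Printing Implicit Defensive.

Local Open Scope ring_scope.
Local Open Scope classical_set_scope.

(** * One-variable derivative tests at a minimum *)

Lemma derive1_gt0_quotient (R : realType) (g : R -> R) (x : R) :
  derivable g x 1 -> 0 < g^`() x ->
  \forall h \near 0^', 0 < h^-1 * (g (h + x) - g x).
Proof.
move=> dg; rewrite derive1E => g0.
have quotient_cvg : h^-1 *: (g (h *: 1 + x) - g x) @[h --> 0^'] --> 'D_1 g x.
  exact: dg.
apply: filterS (cvgr_gt _ quotient_cvg _ g0) => h.
by rewrite -[h *: 1]/(h * 1) mulr1.
Qed.

(** A positive derivative would make [g] strictly smaller just to the left of [x]. Only the left
    side is assumed, because a first crossing time gives control of earlier times only. *)
Lemma derive1_le0_min_left (R : realType) (g : R -> R) (x : R) :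
  derivable g x 1 -> (\forall y \near x^'-, g x <= g y) -> g^`() x <= 0.
Proof.
move=> dg gmin; rewrite leNgt; apply/negP => g0.
have [e /= e0 He] := derive1_gt0_quotient dg g0.
have [d /= d0 Hd] := gmin.
pose k := Num.min e d / 2.
have k0 : 0 < k by rewrite divr_gt0// lt_min e0 d0.
have km : k < Num.min e d by rewrite /k; move: k0; rewrite /k; lra.
have := He (- k); rewrite /= sub0r opprK gtr0_norm//.
have /andP[ke kd] : (k < e) && (k < d) by rewrite -lt_min.
rewrite oppr_eq0 gt_eqF// => /(_ ke isT).
have := Hd (- k + x); rewrite /= opprD opprK addrCA subrr addr0 gtr0_norm//.
move=> /(_ kd); rewrite gtrDr oppr_lt0 => /(_ k0) gk.
by rewrite invrN mulNr oppr_gt0 pmulr_rlt0 ?invr_gt0// subr_lt0 ltNge gk.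
Qed.

(** If the second derivative were negative, then, the first one vanishing at [x], the slope of [g]
    would be negative just to the right of [x], and the mean value theorem would give a smaller
    value there. *)
Lemma derive1_derive1_ge0_min (R : realType) (g : R -> R) (x : R) :
  (\forall y \near x, derivable g y 1) -> derivable g^`() x 1 ->
  (\forall y \near x, g x <= g y) -> 0 <= g^`()^`() x.
Proof.
move=> dg ddg gmin; rewrite leNgt; apply/negP => g0.
have ddN : derivable (- derive1 g) x 1 by exact: derivableN.
have dN0 : 0 < derive1 (- derive1 g) x by rewrite derive1E deriveN// -derive1E oppr_gt0.
have [e /= e0 He] := derive1_gt0_quotient ddN dN0.
have [d /= d0 Hd] : \forall y \near x, derivable g y 1 /\ g x <= g y by near do split.
have dg' y : y \in `]x - d, x + d[%R -> derivable g y 1 /\ g x <= g y.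
  by move=> yd; apply: Hd; rewrite /= distrC ltr_distl; move: yd; rewrite in_itv.
have gx0 : g^`() x = 0.
  rewrite derive1E; apply: derive_val.
  apply: (@derive1_at_min _ g (x - d) (x + d)); first lra.
  - by move=> y /dg' [].
  - rewrite in_itv/=; lra.
  - by move=> y /dg' [].
pose k := Num.min e d / 2.
have k0 : 0 < k by rewrite divr_gt0// lt_min e0 d0.
have km : k < Num.min e d by rewrite /k; move: k0; rewrite /k; lra.
have /andP[ke kd] : (k < e) && (k < d) by rewrite -lt_min.
have xk : x < x + k by lra.
have [||c] := MVT xk (f := g) (df := g^`()).
- move=> y; rewrite in_itv /= => /andP[? ?].
  rewrite derive1E; apply/derivableP; apply: (dg' _ _).1; rewrite in_itv /=; lra.
- apply: derivable_within_continuous => y; rewrite in_itv /= => /andP[? ?].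
  apply: (dg' _ _).1; rewrite in_itv /=; lra.
rewrite in_itv /= => /andP[xc cxk] E.
have gc : g^`() c < 0.
  have := He (c - x); rewrite /= sub0r normrN subrK gtr0_norm ?subr_gt0//.
  rewrite gt_eqF ?subr_gt0// => /(_ _ isT) H.
  have : c - x < e by lra.
  move=> /H; rewrite fctE/= gx0 oppr0 subr0 pmulr_rgt0 ?invr_gt0 ?subr_gt0//.
  by rewrite oppr_gt0.
have : g x <= g (x + k) by apply: (dg' _ _).2; rewrite in_itv /=; lra.
have : derive1 g c * (x + k - x) < 0 by rewrite pmulr_llt0//; lra.
lra.
Unshelve. all: by end_near. Qed.

(** * Nonnegativity of solutions *)

(** Continuity of [f] is relative to [D] and to nonpositive arguments, hence the conditions [D u]
    and [u <= 0]; it carries [0 < f 0] slightly below 0. *)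
Lemma reaction_gt0_near0 (R : realType) (D : set R) (f : R -> R) :
  reaction_term D f ->
  exists2 d, 0 < d & forall u, D u -> - d < u -> u <= 0 -> 0 < f u.
Proof.
move=> hf.
have f0 : 0 < f 0 by apply: (reaction_gt0 hf); rewrite lexx ltr01.
have D0 : (D `&` `]-oo, 0]) 0.
  by split; [apply: (reaction_dom hf)|]; rewrite /= in_itv /= ?lexx ?ltr01.
have /subspace_continuousP/(_ _ D0) fc := reaction_cont hf.
have [d /= d0 Hd] := cvgr_gt _ fc _ f0.
exists d => // u Du du u0; apply: (Hd u); rewrite /= ?sub0r ?normrN.
  by rewrite ler0_norm //; lra.
by split => //=; rewrite in_itv.
Qed.

Lemma open_near_lines (R : realType) (U : set (R * R)) (p : R * R) :
  open U -> U p ->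
  (\forall x \near p.1, U (x, p.2)) /\ (\forall y \near p.2, U (p.1, y)).
Proof.
case: p => a b oU Up.
have [[A B] /= [nA nB] AB] : nbhs (a, b) U by exact: open_nbhs_nbhs.
split => /=.
- apply: filterS nA => x Ax; apply: (AB (x, b)).
  by split => //; exact: nbhs_singleton.
- apply: filterS nB => y By; apply: (AB (a, y)).
  by split => //; exact: nbhs_singleton.
Qed.

Lemma solution_ge0 (R : realType) (D : set R) (f : R -> R) (T : \bar R)
    (Q : set (R * R)) (w : R * R -> R -> R) (p : R * R) (t : R) :
  reaction_term D f -> open Q -> compact (closure Q) -> solution D f T Q w ->
  Q p -> in_time T t -> 0 <= w p t.
Proof.
move=> hf oQ cQ hw Qp [t0 tT]; rewrite leNgt; apply/negP => wneg.
have [d d0 fpos] := reaction_gt0_near0 hf.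
(* [e < d] brings [- e] into the range where [f] is positive, and [e < - w p t] puts [(p, t)] in the
   set [K] below. *)
pose e := Num.min d (- w p t) / 2.
have m0 : 0 < Num.min d (- w p t) by rewrite lt_min d0 oppr_gt0.
have e0 : 0 < e by rewrite divr_gt0.
have em : e < Num.min d (- w p t) by rewrite /e; lra.
have /andP[ed ew] : (e < d) && (e < - w p t) by rewrite -lt_min.
have [reg wD weq wbd winit] := hw.
(* Stopping at time [t < T] makes [A] compact and keeps it where [w] is continuous. *)
pose A : set ((R * R) * R) := closure Q `*` `[0, t].
have cA : compact A by apply: compact_setX => //; exact: segment_compact.
have wA : {within A, continuous (fun q : (R * R) * R => w q.1 q.2)}.
  apply: continuous_subspaceW (regular_cont reg) => -[q s] [/= Qq].
  rewrite in_itv /= => /andP[s0 st]; split => //; split => //=.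
  by apply: le_lt_trans tT; rewrite lee_fin.
pose K := A `&` [set q | w q.1 q.2 <= - e].
have cK : compact K.
  (* The sublevel set is closed only relative to [A]; a closed set [V] of the whole space cuts it
     out of [A]. *)
  have : closed ((fun q : subspace A => w q.1 q.2) @^-1` [set r | r <= - e]).
    by apply: closed_comp => [q _|]; [exact: wA|exact: closed_le].
  move=> /closed_subspaceP[V cV VA].
  have -> : K = A `&` V by rewrite setIC VA setIC.
  exact: compact_closedI.
have K0 : K !=set0.
  exists (p, t); split; [split|] => /=.
  - exact: subset_closure.
  - by rewrite in_itv /= lexx ltW.
  - lra.
(* Minimizing the time coordinate over the compact set [K] yields the first time [s] at which [w] is
   at most [- e] somewhere on [closure Q]. *)
have [[q s] /set_mem[[/= Qq]]] := compact_EVT_min K0 cK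
  (continuous_subspaceT (fun=> cvg_snd)).
rewrite in_itv /= => /andP[s0 st] wqs smin.
have before r u : closure Q r -> 0 <= u < s -> - e < w r u.
  move=> Qr /andP[u0 us]; rewrite ltNge; apply/negP => wru.
  have /smin /= : (r, u) \in K.
    by apply/mem_set; split => //; split => //=; rewrite in_itv /= u0 (le_trans (ltW us)).
  by rewrite leNgt us.
have {}s0 : 0 < s.
  rewrite lt_neqAle s0 andbT; apply/eqP => s00.
  by move: wqs; rewrite -s00 winit//; lra.
have sT : in_time T s by split => //; apply: le_lt_trans tT; rewrite lee_fin.
(* As [Q] is open, a point of its closure outside [Q] is a boundary point, where [w] vanishes. *)
have {}Qq : Q q.
  apply: contrapT => nQ.
  have : boundary Q q by split => //; move: oQ => /interior_id ->.
  by move=> /wbd /(_ sT) w0; move: wqs; rewrite w0; lra.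
(* If [w r s < - e], then, starting from 0 at time 0, [w r] takes the value [- e] at some time in
   [[0, s]]: a time before [s] contradicts [before], and [s] itself contradicts the strict
   inequality. *)
have at_s r : Q r -> - e <= w r s.
  move=> Qr; rewrite leNgt; apply/negP => wrs.
  have cr : {within `[0, s], continuous (w r)}.
    apply/subspace_continuousP => u; rewrite /= in_itv /= => /andP[u0 us].
    have Aru : A (r, u).
      by split => /=; [exact: subset_closure|rewrite in_itv /= u0 (le_trans us)].
    move/subspace_continuousP : wA => /(_ _ Aru) wA.
    apply: (cvg_comp (fun v => (r, v)) (fun q => w q.1 q.2) _ wA).
    move=> B; rewrite /within /= => -[[B1 B2] /= [rB1 uB2] BB].
    apply: filterS uB2 => v vB2; rewrite in_itv /= => /andP[v0 vs].
    apply: (BB (r, v)) => /=; first by split => //=; exact: nbhs_singleton.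
    by split => /=; [exact: subset_closure|rewrite in_itv /= v0 (le_trans vs)].
  have [||u] := IVT (v := - e) _ cr; first exact: ltW.
    rewrite winit; last exact: subset_closure.
    by rewrite ge_min le_max (ltW wrs) orbT oppr_le0 ltW.
  rewrite in_itv /= => /andP[u0 us] wu.
  have [us'|su] := ltP u s.
    have := before r u (subset_closure Qr); rewrite wu ltxx u0 us'.
    by move=> /(_ isT).
  have us_eq : u = s by apply/le_anti; rewrite us su.
  by move: wrs; rewrite -us_eq wu ltxx.
have wE : w q s = - e by apply/le_anti; rewrite wqs at_s.
(* [- e] belongs to [D] because it is the value of the solution at [(q, s)]. *)
have fe : 0 < f (- e) by apply: fpos; [rewrite -wE; exact: wD|lra|lra].
have dt : d_t w q s <= 0.
  apply: derive1_le0_min_left; first exact: (regular_t reg).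
  near=> u; rewrite wE ltW// before//; first exact: subset_closure.
  by apply/andP; split; near: u; [exact: nbhs_left_ge|exact: nbhs_left_lt].
have [nx ny] := open_near_lines oQ Qq.
have dx : 0 <= d_x (d_x w) q s.
  apply: derive1_derive1_ge0_min; last 2 first.
  - exact: (regular_xx reg).
  - by apply: filterS nx => x Qx; rewrite /= -surjective_pairing wE at_s.
  - by apply: filterS nx => x Qx; exact: (regular_x reg Qx sT).
have dy : 0 <= d_y (d_y w) q s.
  apply: derive1_derive1_ge0_min; last 2 first.
  - exact: (regular_yy reg).
  - by apply: filterS ny => y Qy; rewrite /= -surjective_pairing wE at_s.
  - by apply: filterS ny => y Qy; exact: (regular_y reg Qy sT).
by have := weq _ _ Qq sT; rewrite /laplacian wE; lra.
Unshelve. all: by end_near. Qed.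

(** * Locality of the derivatives on an open set *)

Section LocalDerivatives.
Variables (R : realType) (U : set (R * R)) (v w : R * R -> R -> R).
Hypotheses (oU : open U) (vw : forall p, U p -> v p = w p).

Lemma near_eq_lines (p : R * R) (t : R) : U p ->
  (\forall x \near p.1, w (x, p.2) t = v (x, p.2) t) /\
  (\forall y \near p.2, w (p.1, y) t = v (p.1, y) t).
Proof.
move=> Up; have [nx ny] := open_near_lines oU Up.
by split; [apply: filterS nx|apply: filterS ny] => z /vw ->.
Qed.

Lemma derivable_x_local (p : R * R) (t : R) : U p ->
  derivable (fun x => w (x, p.2) t) p.1 1 ->
  derivable (fun x => v (x, p.2) t) p.1 1.
Proof. by move=> /(near_eq_lines t)[+ _]; exact: near_eq_derivable. Qed.

Lemma derivable_y_local (p : R * R) (t : R) : U p ->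
  derivable (fun y => w (p.1, y) t) p.2 1 ->
  derivable (fun y => v (p.1, y) t) p.2 1.
Proof. by move=> /(near_eq_lines t)[_ +]; exact: near_eq_derivable. Qed.

(** An equality of functions of [t] has the form of the hypothesis [vw], so the lemma applies again
    to [d_x v] and [d_x w] and yields the second derivatives. *)
Lemma d_x_local (p : R * R) : U p -> d_x v p = d_x w p.
Proof.
move=> Up; apply/funext => t; have [nx _] := near_eq_lines t Up.
by rewrite /d_x !derive1E; apply/esym/near_eq_derive.
Qed.

Lemma d_y_local (p : R * R) : U p -> d_y v p = d_y w p.
Proof.
move=> Up; apply/funext => t; have [_ ny] := near_eq_lines t Up.
by rewrite /d_y !derive1E; apply/esym/near_eq_derive.
Qed.

End LocalDerivatives.

Lemma laplacian_local (R : realType) (U : set (R * R)) (v w : R * R -> R -> R)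
    (p : R * R) (t : R) :
  open U -> (forall q, U q -> v q = w q) -> U p ->
  laplacian v p t = laplacian w p t.
Proof.
move=> oU vw Up; rewrite /laplacian.
by rewrite (d_x_local oU (d_x_local oU vw))// (d_y_local oU (d_y_local oU vw)).
Qed.

(** Agreement is asked on [closure U] because continuity reaches the boundary; the derivatives see
    only the open set [U]. *)
Lemma regular_local (R : realType) (T : \bar R) (U Q : set (R * R))
    (v w : R * R -> R -> R) :
  open U -> U `<=` Q -> (forall p, closure U p -> v p = w p) ->
  regular T Q w -> regular T U v.
Proof.
move=> oU UQ vwc [wc wt wx wy wxx wyy].
have vw p : U p -> v p = w p by move=> Up; apply: vwc; exact: subset_closure.
split.
- apply: (@subspace_eq_continuous _ _ _ (fun q => w q.1 q.2)).
    by move=> q /set_mem[/= Uq _]; rewrite /from_subspace vwc.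
  apply: continuous_subspaceW wc => -[q s] [/= Uq ?].
  by split => //; exact: closure_subset Uq.
- by move=> p t Up tT; rewrite vw//; exact: wt (UQ _ Up) tT.
- by move=> p t Up tT; apply: (derivable_x_local oU vw Up); exact: wx (UQ _ Up) tT.
- by move=> p t Up tT; apply: (derivable_y_local oU vw Up); exact: wy (UQ _ Up) tT.
- move=> p t Up tT; apply: (derivable_x_local oU (d_x_local oU vw) Up).
  exact: wxx (UQ _ Up) tT.
- move=> p t Up tT; apply: (derivable_y_local oU (d_y_local oU vw) Up).
  exact: wyy (UQ _ Up) tT.
Qed.

(** * Rectangles and the restricted solution *)

Lemma open_rectangle_compact_closure (R : realType) (Q : set (R * R)) :
  open_rectangle Q -> compact (closure Q).
Proof.
move=> [a [b [c [d [_ _ ->]]]]].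
have cI : compact (`[a, b] `*` `[c, d]).
  by apply: compact_setX; exact: segment_compact.
apply: (subclosed_compact (@closed_closure _ _) cI).
rewrite [X in _ `<=` X](closure_id _).1; last first.
  by apply: compact_closed => //; exact: norm_hausdorff.
by apply: closure_subset => -[x y] [/= xab ycd]; split => /=; exact: subset_itv_oo_cc.
Qed.

Lemma open_rectangle_open (R : realType) (Q : set (R * R)) :
  open_rectangle Q -> open Q.
Proof.
move=> [a [b [c [d [_ _ ->]]]]]; rewrite openE => -[x y] [/= xab ycd].
exists (`]a, b[, `]c, d[) => //=.
by split; apply: open_nbhs_nbhs; split => //; exact: itv_open.
Qed.

Theorem theorem2 (R : realType) (D : set R) (f : R -> R) (T : \bar R)
    (Omega Q : set (R * R)) (w : R * R -> R -> R)
    (hf : reaction_term D f)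
    (hT : (0 < T)%E)
    (Omega_open : open Omega) (Omega_neq0 : Omega !=set0)
    (Omega_connected : connected Omega)
    (Omega_boundary : piecewise_smooth_boundary Omega)
    (hQ : minimal_rectangle Omega Q)
    (hw : solution D f T Q w) :
  upper_solution D f T Omega (w \_ (closure Q `&` closure Omega)).
Proof.
have [rQ OQ _] := hQ; have [reg wD weq wbd winit] := hw.
have oQ := open_rectangle_open rQ.
set v := w \_ _.
(* Every condition on an upper solution lives on [closure Omega], which lies in [closure Q], so the
   default value of [v] elsewhere never enters. *)
have vwc p : closure Omega p -> v p = w p.
  by move=> Op; rewrite /v patchT//; apply/mem_set; split => //; exact: closure_subset Op.
have vw p : Omega p -> v p = w p by move=> Op; apply: vwc; exact: subset_closure.
split.
- exact: regular_local reg.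
- by move=> p t Op tT; rewrite vw//; apply: wD => //; exact: OQ.
- move=> p t Op tT; rewrite (laplacian_local _ Omega_open vw)// /d_t vw//.
  by rewrite -weq//; exact: OQ.
- move=> p t [Op _] tT; rewrite vwc//.
  (* A boundary point of [Omega] is either inside [Q], where [w] is nonnegative, or on the boundary
     of [Q], where it is 0. *)
  have [Qp|nQp] := pselect (Q p).
    exact: solution_ge0 (open_rectangle_compact_closure rQ) hw Qp tT.
  rewrite wbd//; split; first exact: closure_subset Op.
  by move: oQ => /interior_id ->.
- by move=> p Op; rewrite vwc// winit//; exact: closure_subset Op.
Qed.
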